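(* Let $S$ be a finite non-abelian simple group, and let $P \neq \mathbb{Z}_2$ be a $2$-transitive permutation group on $n \ge 2$ points. Then $$m(S) + m(P) \leq m(S \wr P) \leq m(S) + m(P) + 1.$$ Moreover: (i) if $S$ does not satisfy the replacement property, then $m(S \wr P) = m(S) + m(P) + 1$; (ii) if $S$ satisfies the replacement property, then $m(S \wr P) = m(S) + m(P)$.
   Context: For a finite group $G$, a set $\{g_1,\dots,g_r\}$ of elements of $G$ is irredundant if for every $j$ the subgroup $\langle g_i : i \neq j\rangle$ is different from $\langle g_1,\dots,g_r\rangle$; it is an irredundant generating set of $G$ if moreover it generates $G$. $m(G)$ denotes the maximal size of an irredundant generating set of $G$. A finite group $G$ with $m = m(G)$ satisfies the replacement property if for any irredundant generating set $\{h_1,\dots,h_m\}$ of size $m$ of $G$ and any non-identity $h \in G$, there exists $i$ such that $\{h_j : j \neq i\} \cup \{h\}$ still generates $G$. For a permutation group $P \leq S_n$, $S \wr P = S^n \rtimes P$, where $P$ acts on $S^n$ by permuting the $n$ copies of $S$. *)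

(* Defs.v *)
From mathcomp Require Import all_boot all_fingroup zmodp all_solvable.

Set Implicit Arguments.
Unset Strict Implicit.
Unset Printing Implicit Defensive.

Import GroupScope.

Section Irredundance.

Variable gT : finGroupType.
Implicit Types (X : {set gT}) (G : {group gT}).

Definition irredundant X := [forall x in X, <<X :\ x>> != <<X>>].

Definition irredundant_generating G X := irredundant X && (<<X>> == G).

Definition max_irredundant G : nat :=
  \max_(X : {set gT} | irredundant_generating G X) #|X|.

Definition replacement_property G : Prop :=
  forall X, irredundant_generating G X -> #|X| = max_irredundant G ->
  forall h, h \in G -> h != 1 ->
  exists2 x, x \in X & <<h |: (X :\ x)>> = G.

End Irredundance.

Section WreathProduct.

Variables (gT : finGroupType) (n : nat).

Local Notation gTn := {dffun forall i : 'I_n, gT}.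

(* The product s * t of permutations maps i to t (s i), so this is a right
   action; it moves the i-th coordinate of f to position s i. *)
Definition permute_coords (f : gTn) (s : 'S_n) : gTn :=
  [ffun i => f (s^-1 i)].

Fact permute_coords_is_action : is_action [set: 'S_n] permute_coords.
Proof.
apply: is_total_action => [f | f s t]; apply/ffunP => i.
  by rewrite ffunE invg1 perm1.
by rewrite !ffunE invMg permM.
Qed.

Canonical permute_coords_action := Action permute_coords_is_action.

Fact permute_coords_is_groupAction :
  is_groupAction [set: gTn] permute_coords_action.
Proof.
move=> s _; rewrite /= inE; apply/andP; split.
  by apply/subsetP => f _; rewrite inE.
apply/morphicP => f g _ _; rewrite !actpermE /=.
by apply/ffunP => i; rewrite !ffunE.
Qed.

Canonical permute_coords_groupAction :=
  GroupAction permute_coords_is_groupAction.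

Variables (S : {group gT}) (P : {group 'S_n}).

Definition base_group : {group gTn} := [group of setXn (fun _ : 'I_n => S)].

Fact permute_coords_acts_on_base :
  {acts P, on group base_group | permute_coords_groupAction}.
Proof.
split; last exact: subsetT.
apply/subsetP=> s Ps; rewrite !inE /=; apply/subsetP => f /setXnP Sf.
by rewrite inE; apply/setXnP => i; rewrite ffunE.
Qed.

Definition wreath_action : groupAction P base_group :=
  <[permute_coords_acts_on_base]>%gact.

Definition wreath : finGroupType := sdprod_groupType wreath_action.

Definition wreath_group : {group wreath} := [set: wreath]%G.

End WreathProduct.

(* Main.v *)
Require Import Defs.
From mathcomp Require Import all_boot all_fingroup zmodp all_solvable.

Set Implicit Arguments.
Unset Strict Implicit.
Unset Printing Implicit Defensive.

Import GroupScope.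

(** Write W for the wreath product and N for its base group, the kernel of the
    projection of W onto P. The two hypotheses on P together give at least
    three points, since on two points the only 2-transitive group is cyclic of
    order 2.

    Lower bounds. Lift an irredundant generating set of P to the standard
    complement, and add elements of N. Adding x in one fixed coordinate (and 1
    elsewhere), for each x in an irredundant generating set of S of maximal
    size, gives a set with m(S) + m(P) elements: without one of these x, all
    coordinates lie in a proper subgroup of S. If the replacement property
    fails for such a set and some h, add instead the constant tuples x
    together with h in one coordinate: without h only constant tuples remain,
    and without x the coordinates generate a proper subgroup because h does
    not replace x. This gives one more element.

    Upper bounds. Let X be an irredundant generating set of W. Choose a minimal
    Y in X whose image generates P, and then a minimal Z with Y in Z in X such
    that the coordinates of the elements of Z generate S. Both choices give
    irredundant families of subsets, of P and of S, and such a family has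
    at most m(P), respectively m(S), members beyond its fixed part
    (leq_card_family); so |Y| <= m(P) and |Z \ Y| <= m(S). The
    coordinates of W depend on a choice of identifications between the n
    copies of S, and they can be chosen so that <Y> transports every copy to
    every other one trivially (regauge_anchored); then the coordinates of <Z>
    are really the action of point stabilisers on one copy of S.

    The key fact is base_dichotomy: if a subgroup K over P has such full
    coordinates, then its intersection with N is trivial, or a diagonal copy
    of S, or all of N. Hence X has at most one element outside Z when Y and Z
    differ, and at most two when they agree; in the second case 2 <= m(S)
    because S is not cyclic. So |X| <= m(S) + m(P) + 1.

    Suppose now that S has the replacement property, |Z \ Y| = m(S), and X
    has an extra element x. A nontrivial coordinate of an element of Y would
    replace one of the coordinates contributed by Z \ Y, against the
    minimality of Z; so in these coordinates <Y> is the standard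
    complement. A nontrivial coordinate of x does replace some z, so Z and (Z \ z) with x both generate subgroups
    that meet N in a diagonal. On at least three points the only diagonal
    normalised by the standard complement is the constant one
    (flat_diagonal_constant). Then all elements of X, and so all of W, would
    have constant coordinates, which is absurd. *)

(** * Irredundant sets and families *)

Lemma gen_ind (gT : finGroupType) (R : gT -> Prop) (A : {set gT}) :
    R 1 -> (forall u v, R u -> R v -> R (u * v)) ->
    (forall a, a \in A -> R a) ->
  forall w, w \in <<A>> -> R w.
Proof.
move=> R1 RM RA w /gen_prodgP[k [c Ac ->]].
by apply: (big_ind R) => // i _; apply: RA.
Qed.

Section IrredundantSets.

Variable gT : finGroupType.
Implicit Types (A X : {set gT}) (Q : {group gT}).

Lemma irredundant_notin_gen X A x :
  irredundant X -> A \subset X -> x \in X -> x \notin A -> x \notin <<A>>.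
Proof.
move=> /forall_inP irrX sAX Xx nAx; apply/negP=> genAx.
have /eqP := irrX x Xx; apply; apply/eqP.
rewrite eqEsubset genS ?subsetDl //= gen_subG.
have sAXx: A \subset X :\ x by rewrite subsetD1 sAX.
by rewrite -{1}(setD1K Xx) subUset sub1set (subsetP (genS sAXx)) // subset_gen.
Qed.

Lemma irredundant_gen_exists A Q :
  <<A>> = Q -> exists2 X, irredundant_generating Q X & X \subset A.
Proof.
move=> genA; pose genQ X := <<X>> == Q.
have [X /minsetP[genX minX] sXA] : {X | minset genQ X & X \subset A}.
  by apply: minset_exists; rewrite /genQ genA.
exists X => //; rewrite /irredundant_generating [<<X>> == _]genX andbT.
apply/forall_inP=> x Xx; apply/eqP=> eqXx.
have /setP/(_ x) : X :\ x = X.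
  by apply: minX; rewrite ?subsetDl // /genQ eqXx.
by rewrite !inE Xx eqxx.
Qed.

Lemma leq_max_irredundant Q X :
  irredundant_generating Q X -> #|X| <= max_irredundant Q.
Proof. by move=> irrX; apply: (@leq_bigmax_cond _ _ (fun X => #|X|)). Qed.

Lemma max_irredundant_attained Q :
  exists2 X, irredundant_generating Q X & #|X| = max_irredundant Q.
Proof.
have [X0 irrX0 _] := irredundant_gen_exists (genGid Q).
have [|X irrX eqX] :=
  @eq_bigmax_cond _ (irredundant_generating Q) (fun X => #|X|).
  by apply/card_gt0P; exists X0.
by exists X.
Qed.

Lemma max_irredundant_gt1 Q : ~~ abelian Q -> 1 < max_irredundant Q.
Proof.
apply: contraR; rewrite -leqNgt; have [X irrX <-] := max_irredundant_attained Q.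
case/andP: irrX => _ /eqP <-; rewrite abelian_gen.
case: (set_0Vmem X) => [-> _|[x Xx]]; first by rewrite abelianE sub0set.
rewrite (cardsD1 x) Xx ltnS leqn0 cards_eq0 => /eqP X'0.
by rewrite -(setD1K Xx) X'0 setU0 -abelian_gen cycle_abelian.
Qed.

(** Any irredundant generating set extracted from the union needs, for each
    index j, an element that only A j can supply; picking one for each j is
    injective. The fixed part B may contribute further elements. *)
Lemma irredundant_family (I : finType) (J : {set I}) (B : {set gT})
    (A : I -> {set gT}) Q :
    <<B :|: \bigcup_(j in J) A j>> = Q ->
    (forall j, j \in J -> <<B :|: \bigcup_(k in J :\ j) A k>> <> Q) ->
  exists2 X, irredundant_generating Q X
    & exists2 f : I -> gT, {in J &, injective f}
                         & forall j, j \in J -> f j \in X :&: A j.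
Proof.
move=> genJ irrJ; have [X irrX sXA] := irredundant_gen_exists genJ.
exists X => //; case/andP: irrX => _ /eqP genX.
have spare j: j \in J ->
  exists x, (x \in X) && (x \notin B :|: \bigcup_(k in J :\ j) A k).
- move=> Jj; apply/existsP; apply: contraT => /existsPn sX; case: (irrJ j Jj).
  apply/eqP; rewrite eqEsubset; apply/andP; split.
    rewrite -genJ genS // setUS //; apply/bigcupsP=> k /setD1P[_ Jk].
    exact: bigcup_sup.
  rewrite -genX genS //; apply/subsetP=> x Xx.
  by have:= sX x; rewrite Xx negbK.
pose f j :=
  odflt 1 [pick x | (x \in X) && (x \notin B :|: \bigcup_(k in J :\ j) A k)].
have fP j: j \in J ->
    (f j \in X) && (f j \notin B :|: \bigcup_(k in J :\ j) A k).
  move=> Jj; rewrite /f; case: pickP => [x //|no_x].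
  by have [x] := spare j Jj; rewrite no_x.
have fA j: j \in J -> f j \in A j.
  case/fP/andP=> Xf; rewrite inE => /norP[/negPf nBf /negP nAf].
  have:= subsetP sXA _ Xf; rewrite inE nBf => /bigcupP[k Jk Ak].
  have [eqkj|nkj] := eqVneq k j; first by rewrite -{2}eqkj.
  case: nAf; apply/bigcupP.
  by exists k; rewrite // !inE nkj.
exists f => [j k Jj Jk eqf|j Jj]; last first.
  by rewrite inE fA ?andbT //; case/andP: (fP j Jj).
apply/eqP; apply: contraT => njk; have /andP[_ /setUP[]] := fP j Jj; right.
by apply/bigcupP; exists k; rewrite ?eqf ?fA // !inE eq_sym njk.
Qed.

Lemma leq_card_family (I : finType) (J : {set I}) (B : {set gT})
    (A : I -> {set gT}) Q :
    <<B :|: \bigcup_(j in J) A j>> = Q ->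
    (forall j, j \in J -> <<B :|: \bigcup_(k in J :\ j) A k>> <> Q) ->
  #|J| <= max_irredundant Q.
Proof.
move=> genJ /(irredundant_family genJ)[X irrX [f injf fXA]].
rewrite -(card_in_imset injf) (leq_trans _ (leq_max_irredundant irrX)) //.
apply/subset_leq_card/subsetP=> _ /imsetP[j Jj ->].
by case/setIP: (fXA j Jj).
Qed.

End IrredundantSets.

(** * Coordinates on a wreath product *)

Section WreathCoordinates.

Variables (gT wT : finGroupType) (n : nat).

(** An element w acts on S * 'I_n on the right by sending (x, i) to
    (x * d w i, q w i), which is why d is a cocycle over q. Only these axioms
    are used below, since they are preserved when the copies of S are
    identified differently, whereas the standard coordinates are not. *)
Record wreath_coordinates (S : {group gT}) (P : {group 'S_n})
    (q : wT -> 'S_n) (d : wT -> 'I_n -> gT) : Prop := WreathCoordinates {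
  wc_permM : forall u v, q (u * v) = q u * q v;
  wc_coordM : forall u v i, d (u * v) i = d u i * d v (q u i);
  wc_perm : forall u, q u \in P;
  wc_coord : forall u i, d u i \in S;
  wc_inj : forall u v, q u = q v -> d u =1 d v -> u = v;
  wc_surj : forall p (f : 'I_n -> gT), p \in P -> (forall i, f i \in S) ->
    exists2 u, q u = p & d u =1 f
}.

Variables (S : {group gT}) (P : {group 'S_n}).
Variables (q : wT -> 'S_n) (d : wT -> 'I_n -> gT).

Definition coord_values (A : {set wT}) : {set gT} := d @2: (A, [set: 'I_n]).

(** K contains transporters between any two copies of S that act as the
    identity on S. *)
Definition anchored (K : {set wT}) :=
  forall i j, exists2 w, w \in K & q w i = j /\ d w i = 1.

(** Every single coordinate identifies the base part of K with S, so this base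
    part is the graph of a tuple of automorphisms of S. *)
Definition diagonal (K : {set wT}) :=
  forall i, (forall m, m \in K -> q m = 1 -> d m i = 1 -> m = 1)
    /\ (forall s, s \in S -> exists2 m, m \in K & q m = 1 /\ d m i = s).

Hypothesis wc : wreath_coordinates S P q d.

Implicit Type A : {set wT}.

Let qM := wc_permM wc.
Let dM := wc_coordM wc.

Lemma perm_one : q 1 = 1.
Proof. by apply: (mulgI (q 1)); rewrite -qM !mulg1. Qed.

Lemma permV u : q u^-1 = (q u)^-1.
Proof. by apply/(mulgI (q u)); rewrite -qM !mulgV perm_one. Qed.

Lemma coord1 i : d 1 i = 1.
Proof.
by apply: (mulgI (d 1 i)); have := dM 1 1 i; rewrite !mulg1 perm_one perm1.
Qed.

Lemma coordV u i : d u^-1 (q u i) = (d u i)^-1.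
Proof. by apply: (mulgI (d u i)); rewrite -dM !mulgV coord1. Qed.

Lemma coordJ m k i : q m = 1 -> d (m ^ k) (q k i) = d m i ^ d k i.
Proof.
by move=> qm; rewrite !conjgE !dM coordV permV permK qm perm1.
Qed.

Lemma permJ m k : q m = 1 -> q (m ^ k) = 1.
Proof. by move=> qm; rewrite conjgE !qM qm mul1g permV mulVg. Qed.

Lemma coord_mem_gen A i w : w \in A -> d w i \in <<coord_values A>>.
Proof. by move=> Aw; apply/mem_gen/imset2P; exists w i. Qed.

Lemma coord_gen (T : {group gT}) A :
    (forall a i, a \in A -> d a i \in T) ->
  forall w i, w \in <<A>> -> d w i \in T.
Proof.
move=> TA w i Aw; move: w Aw i.
apply: gen_ind => [i|u v Tu Tv i|a Aa i].
- by rewrite coord1.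
- by rewrite dM groupM.
exact: TA.
Qed.

Lemma coord_constant_gen A :
    (forall a i j, a \in A -> d a i = d a j) ->
  forall w i j, w \in <<A>> -> d w i = d w j.
Proof.
move=> TA w i j Aw; move: w Aw i j.
apply: gen_ind => [i j|u v Tu Tv i j|a Aa i j].
- by rewrite !coord1.
- by rewrite !dM (Tu i j) (Tv (q u i) (q u j)).
exact: TA.
Qed.

Lemma coord_values_gen A : <<coord_values <<A>>>> = <<coord_values A>>.
Proof.
apply/eqP; rewrite eqEsubset; apply/andP; split.
  rewrite gen_subG; apply/subsetP=> _ /imset2P[w i Aw _ ->].
  by apply: coord_gen Aw => a j; apply: coord_mem_gen.
by rewrite genS // imset2Sl // subset_gen.
Qed.

Lemma coord_values_sub A : <<coord_values A>> \subset S.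
Proof.
rewrite gen_subG; apply/subsetP=> _ /imset2P[w i _ _ ->].
exact: wc_coord wc _ _.
Qed.

Lemma anchoredS (H K : {set wT}) : H \subset K -> anchored H -> anchored K.
Proof.
move=> sHK aH i j; have [w Hw dw] := aH i j.
by exists w; rewrite ?(subsetP sHK).
Qed.

(** Composing with trivial transporters turns any coordinate of an element of K
    into a coordinate of an element fixing the point i, so the point
    stabiliser already acts on its copy of S through all the coordinates. *)
Lemma stab_coord_full (K : {group wT}) :
    anchored K -> S \subset <<coord_values K>> ->
  forall i s, s \in S -> exists2 k, k \in K & q k i = i /\ d k i = s.
Proof.
move=> aK genK i s Ss; pose T := [set d k i | k in K & q k i == i].
have gT_: group_set T.
  apply/group_setP; split=> [|_ _ /imsetP[u /setIdP[Ku /eqP qu] ->]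
                              /imsetP[v /setIdP[Kv /eqP qv] ->]].
    by apply/imsetP; exists 1; rewrite ?coord1 // inE group1 perm_one perm1 /=.
  apply/imsetP; exists (u * v); last by rewrite dM qu.
  by rewrite inE groupM // qM permM qu qv /=.
suffices /subsetP/(_ s): <<coord_values K>> \subset Group gT_.
  move/(_ (subsetP genK s Ss)) => /imsetP[k /setIdP[Kk /eqP qk] ->].
  by exists k.
rewrite gen_subG; apply/subsetP=> _ /imset2P[w j Kw _ ->].
have [a Ka [qa da]] := aK i j; have [b Kb [qb db]] := aK (q w j) i.
apply/imsetP; exists (a * w * b).
  by rewrite inE !groupM //= !qM !permM qa qb.
by rewrite !dM qM permM qa da db mul1g mulg1.
Qed.

(** * The base part of a subgroup with full coordinates *)

Hypotheses (simS : simple S) (nabS : ~~ abelian S).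
Hypothesis tr2 : forall i j k l : 'I_n, i != j -> k != l ->
  exists2 p, p \in P & p i = k /\ p j = l.

Implicit Types B C : {set 'I_n}.

(** The elements of K in the base group whose coordinates at the points of B
    vanish. *)
Definition base_part (K : {set wT}) (B : {set 'I_n}) : {set wT} :=
  [set m in K | (q m == 1) && [forall j in B, d m j == 1]].

Lemma base_partP (K : {set wT}) B m :
  reflect [/\ m \in K, q m = 1 & forall j, j \in B -> d m j = 1]
          (m \in base_part K B).
Proof.
rewrite inE; apply: (iffP and3P) => [[Km /eqP qm /forall_inP dm]|[Km qm dm]].
  by split=> // j Aj; apply/eqP/dm.
by split=> //; [apply/eqP | apply/forall_inP=> j Aj; apply/eqP/dm].
Qed.

Lemma base_part_group_set (K : {group wT}) B : group_set (base_part K B).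
Proof.
apply/group_setP; split=> [|u v /base_partP[Ku qu du] /base_partP[Kv qv dv]].
  by apply/base_partP; rewrite perm_one; split=> // j _; rewrite coord1.
apply/base_partP; rewrite groupM // qM qu qv mulg1; split=> // j Aj.
by rewrite dM qu perm1 du // dv // mulg1.
Qed.

Canonical base_part_group K B := Group (base_part_group_set K B).

(** On the base group a coordinate is a morphism; a name of its own lets this
    morphism structure be inferred. *)
Definition coord_on_base i w := d w i.

Lemma coord_on_base_morph i :
  {in base_part [set: wT] set0 &, {morph coord_on_base i : u v / u * v}}.
Proof.
by move=> u v /base_partP[_ qu _] _; rewrite /coord_on_base dM qu perm1.
Qed.

Canonical coord_on_base_morphism i := Morphism (@coord_on_base_morph i).

Lemma base_partS (K : {set wT}) B C : C \subset B ->
  base_part K B \subset base_part K C.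
Proof.
move=> sCB; apply/subsetP=> m /base_partP[Km qm dm]; apply/base_partP.
by split=> // j Bj; rewrite dm ?(subsetP sCB).
Qed.

Lemma base_part_dom (K : {set wT}) B :
  base_part K B \subset base_part [set: wT] set0.
Proof.
apply/subsetP=> m /base_partP[Km qm dm]; apply/base_partP.
by split=> // j; rewrite ?inE.
Qed.

Lemma coord_baseP (K : {set wT}) B i s :
  reflect (exists2 m, m \in base_part K B & d m i = s)
          (s \in coord_on_base i @* base_part K B).
Proof.
apply: (iffP idP) => [/morphimP[m _ Mm ->]|[m Mm <-]]; first by exists m.
by apply: mem_morphim; rewrite // (subsetP (base_part_dom K B)).
Qed.

Lemma base_part_normal (K : {group wT}) B :
  base_part K B <| base_part K set0.
Proof.
apply/normalP; split=> [|k /base_partP[Kk qk _]]; first exact/base_partS/sub0set.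
have sub k': k' \in K -> q k' = 1 -> base_part K B :^ k' \subset base_part K B.
  move=> Kk' qk'; apply/subsetP=> _ /imsetP[m /base_partP[Km qm dm] ->].
  apply/base_partP; rewrite groupJ // permJ //; split=> // j Aj.
  by have := coordJ k' j qm; rewrite qk' perm1 => ->; rewrite dm ?conj1g.
by apply/eqP; rewrite eqEcard sub //= cardJg.
Qed.

Lemma simple_image (V : {group gT}) s :
  S \subset 'N(V) -> V \subset S -> s \in V -> s != 1 -> V :=: S.
Proof.
move=> nVS sVS Vs nts; case/simpleP: simS => _ /(_ V)[|V1|//].
  exact/andP.
by rewrite V1 inE (negPf nts) in Vs.
Qed.

Lemma simple_perfect : [~: S, S] = S.
Proof.
case/simpleP: simS => _ /(_ [~: S, S]%G)[|/commG1P|//].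
  exact: (der_normal 1 S).
by move=> cSS; case/negP: nabS; rewrite abelianE.
Qed.

(** Each coordinate image of the base part M of K is normalised by S, so it is
    S. For j <> i the elements of M that vanish at j form a normal subgroup of
    M, whose image at i is therefore 1 or S. If it is always 1, then M is
    diagonal. Otherwise it is always S by 2-transitivity, and since S is
    perfect, commutators of elements that vanish at different points produce
    every element supported at a single point. *)
Lemma base_dichotomy (K : {group wT}) m :
    P \subset q @: K -> anchored K -> S \subset <<coord_values K>> ->
    m \in K -> q m = 1 -> m != 1 ->
  K :=: [set: wT] \/ diagonal K.
Proof.
move=> ontoK aK genK Km qm ntm.
pose V i B := (coord_on_base i @* base_part K B)%G.
have sVS i B: V i B \subset S.
  by apply/subsetP=> _ /coord_baseP[u _ <-]; apply: wc_coord wc _ _.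
have nVS i: S \subset 'N(V i set0).
  apply/subsetP=> s Ss; have [k Kk [qk <-]] := stab_coord_full aK genK i Ss.
  rewrite inE; apply/subsetP=> _ /imsetP[_ /coord_baseP[u Mu <-] ->].
  have /base_partP[Ku qu _] := Mu.
  apply/coord_baseP; exists (u ^ k); last by rewrite -{1}qk coordJ.
  by apply/base_partP; rewrite groupJ // permJ //; split=> // j; rewrite inE.
have [i0 dm0]: exists i, d m i != 1.
  apply/existsP; apply: contraNT ntm => /existsPn dm1; apply/eqP.
  apply: (wc_inj wc) => [|i]; first by rewrite perm_one.
  by rewrite coord1; apply/eqP; rewrite -[_ == _]negbK dm1.
have VS i: V i set0 :=: S.
  have [w Kw [qw dw]] := aK i0 i.
  apply: (@simple_image _ (d (m ^ w) i)) => //.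
    apply/coord_baseP; exists (m ^ w) => //; apply/base_partP.
    by rewrite groupJ // permJ //; split=> // j; rewrite inE.
  by rewrite -qw coordJ // dw conjg1.
have VAS B i u: u \in base_part K B -> d u i != 1 -> V i B :=: S.
  move=> Mu ntu; apply: (@simple_image _ (d u i)) => //.
    by rewrite -(VS i) normal_norm // morphim_normal // base_part_normal.
  by apply/coord_baseP; exists u.
pose mixed := [exists i, exists j, exists u in base_part K [set j], d u i != 1].
have [|/existsPn pure] := boolP mixed; last first.
  right=> i; split=> [u Ku qu du|s]; last first.
    rewrite -(VS i) => /coord_baseP[u /base_partP[Ku qu _] du].
    by exists u.
  apply: (wc_inj wc) => [|j]; first by rewrite perm_one.
  rewrite coord1; apply/eqP; apply: contraT => ntu.
  case/negP: (pure j); apply/existsP; exists i; apply/exists_inP; exists u => //.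
  by apply/base_partP; split=> // k; rewrite inE => /eqP ->.
case/existsP=> i /existsP[j /exists_inP[u Mu ntu]]; left.
have /base_partP[Ku qu du] := Mu.
have nij: i != j by apply: contraNneq ntu => ->; rewrite du ?set11.
have V1S k l: k != l -> V k [set l] :=: S.
  move=> nkl; have [p Pp [pk pl]] := tr2 nij nkl.
  have /imsetP[w Kw qw] := subsetP ontoK p Pp.
  apply: (@VAS _ _ (u ^ w)).
    apply/base_partP; rewrite groupJ // permJ //; split=> // l'.
    by rewrite inE => /eqP->; rewrite -pl qw coordJ // du ?set11 // conj1g.
  rewrite -pk qw coordJ //; apply: contra ntu => /eqP du1.
  by rewrite -(conjg_eq1 _ (d w i)) du1.
(* [M vanishing on B :\ l, M vanishing at l] vanishes on B, and its image at
   k is [S, S] = S. *)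
have VAll B k: k \notin B -> V k B :=: S.
  elim: {B}#|B| {-2}B (leqnn #|B|) => [|c IHc] B.
    by rewrite leqn0 cards_eq0 => /eqP->.
  have [-> //|[l Al]] := set_0Vmem B.
  rewrite (cardsD1 l) Al add1n ltnS => leAc nAk.
  have nkl: k != l by apply: contraNneq nAk => ->.
  apply/eqP; rewrite eqEsubset sVS -{1}simple_perfect.
  rewrite -{1}(IHc (B :\ l)) // ?inE ?(negPf nAk) ?andbF //.
  rewrite -(V1S k l) //= -morphimR ?base_part_dom ?morphimS //.
  have nMM C1 C2: base_part K C1 \subset 'N_(base_part K C1)(base_part K C2).
    rewrite subsetI subxx /= (subset_trans (base_partS K (sub0set C1))) //.
    exact: normal_norm (base_part_normal K C2).
  apply: subset_trans (commg_subI (nMM _ _) (nMM _ _)) _.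
  apply/subsetP=> v /setIP[/base_partP[Kv qv dv] /base_partP[_ _ dvl]].
  apply/base_partP; split=> // j' Aj'; have [->|nj'l] := eqVneq j' l.
    by rewrite dvl ?set11.
  by rewrite dv // !inE nj'l.
(* Peel off one nontrivial coordinate of w at a time. *)
have base_sub w: q w = 1 -> w \in K.
  pose supp v := [set i' | d v i' != 1].
  elim: {w}#|supp w| {-2}w (leqnn #|supp w|) => [|c IHc] w.
    rewrite leqn0 cards_eq0 => /eqP supp0 qw; rewrite (_ : w = 1) ?group1 //.
    apply: (wc_inj wc) => [|k]; first by rewrite perm_one.
    by rewrite coord1; have /setP/(_ k) := supp0; rewrite !inE => /negbFE/eqP.
  move=> leqc qw; have [supp0|[k sk]] := set_0Vmem (supp w).
    by apply: IHc; rewrite // supp0 cards0.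
  have: d w k \in V k [set~ k] by rewrite VAll ?(wc_coord wc) // !inE eqxx.
  case/coord_baseP=> v /base_partP[Kv qv dv] dvk.
  rewrite -(groupMr _ (groupVr Kv)); apply: IHc; last first.
    by rewrite qM permV qw qv mulgV.
  have dvV l: d v^-1 l = (d v l)^-1 by rewrite -coordV qv perm1.
  rewrite -ltnS (leq_trans _ leqc) // (cardsD1 k (supp w)) sk add1n ltnS.
  apply/subset_leq_card/subsetP=> l; rewrite !inE dM qw perm1 dvV.
  have [->|nlk] := eqVneq l k; first by rewrite dvk mulgV eqxx.
  by rewrite dv ?invg1 ?mulg1 // !inE.
apply/eqP; rewrite eqEsubset subsetT; apply/subsetP=> w _.
have /imsetP[k Kk qk] := subsetP ontoK _ (wc_perm wc w).
by rewrite -(groupMl _ (groupVr Kk)) base_sub // qM permV qk mulVg.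
Qed.

Variable i0 : 'I_n.

Lemma kernel_grows (H K : {group wT}) x :
    P \subset q @: H -> H \subset K -> x \in K -> x \notin H ->
  exists2 m, m \in K & q m = 1 /\ m \notin H.
Proof.
move=> ontoH sHK Kx nHx.
have /imsetP[h Hh qh] := subsetP ontoH _ (wc_perm wc x).
exists (h^-1 * x); first by rewrite groupM // groupV (subsetP sHK).
by rewrite qM permV qh mulVg groupMl ?groupV.
Qed.

(** If L were not everything, the base parts of K and L would both be
    identified with S by a single coordinate, hence equal, and K and L realise
    the same permutations. *)
Lemma proper_over_full (K L : {group wT}) m x :
    P \subset q @: K -> anchored K -> S \subset <<coord_values K>> ->
    m \in K -> q m = 1 -> m != 1 ->
    K \subset L -> x \in L -> x \notin K ->
  L :=: [set: wT].
Proof.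
move=> ontoK aK genK Km qm ntm sKL Lx nKx.
have [Kall|dgK] := base_dichotomy ontoK aK genK Km qm ntm.
  by rewrite Kall inE in nKx.
have ontoL := subset_trans ontoK (imsetS q sKL).
have genL := subset_trans genK (genS (imset2Sl d [set: 'I_n] sKL)).
have [//|dgL] :=
  base_dichotomy ontoL (anchoredS sKL aK) genL (subsetP sKL m Km) qm ntm.
have [u Lu [qu nKu]] := kernel_grows ontoK sKL Lx nKx.
have [_ /(_ (d u i0) (wc_coord wc u i0))[v Kv [qv dv]]] := dgK i0.
have [/(_ (v^-1 * u))inj1 _] := dgL i0; case/negP: nKu.
have dV : d v^-1 i0 = (d v i0)^-1 by rewrite -coordV qv perm1.
rewrite -(groupMl _ (groupVr Kv)) inj1 ?group1 //.
- by rewrite groupM ?groupV // (subsetP sKL).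
- by rewrite qM permV qv qu mulVg.
by rewrite dM permV qv invg1 perm1 dV dv mulVg.
Qed.

(** * The upper bound over an anchored part *)

Hypothesis third_point : forall i j : 'I_n, exists k, k != i /\ k != j.

Lemma move_point i j : exists2 p, p \in P & p i = j.
Proof.
have [k [nki _]] := third_point i i; have [l [nlj _]] := third_point j j.
rewrite eq_sym in nki; rewrite eq_sym in nlj.
by have [p Pp [pi _]] := tr2 nki nlj; exists p.
Qed.

(** Conjugating m in the diagonal by h over a permutation fixing i keeps the
    coordinate at i and so keeps m, while it permutes the other coordinates.
    By 2-transitivity the coordinates of m away from i are all equal; a third
    point then compares any two coordinates. *)
Lemma flat_diagonal_constant (H K : {group wT}) :
    P \subset q @: H -> (forall h i, h \in H -> d h i = 1) ->
    H \subset K -> diagonal K ->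
  forall k i j, k \in K -> d k i = d k j.
Proof.
move=> ontoH flatH sHK dgK.
have base_const m: m \in K -> q m = 1 -> forall i j, d m i = d m j.
  move=> Km qm; have off i j k: j != i -> k != i -> d m j = d m k.
    move=> nji nki; rewrite eq_sym in nji; rewrite eq_sym in nki.
    have [p Pp [pi pj]] := tr2 nji nki.
    have /imsetP[h Hh qh] := subsetP ontoH p Pp.
    have dmh l: d (m ^ h) (p l) = d m l.
      by rewrite qh coordJ // (flatH h) // conjg1.
    have Kh := subsetP sHK h Hh.
    have [/(_ (m ^ h * m^-1)) inj1 _] := dgK i.
    have mhm: m ^ h * m^-1 = 1.
      apply: inj1; first by rewrite groupM ?groupV ?groupJ.
        by rewrite qM permJ // permV qm mulgV.
      have dV : d m^-1 i = (d m i)^-1 by rewrite -coordV qm perm1.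
      by rewrite dM permJ // perm1 dV -{1}pi dmh mulgV.
    have eqm: m ^ h = m by apply/eqP; rewrite eq_mulgV1 mhm.
    by rewrite -dmh pj eqm.
  move=> i j; have [k [nki nkj]] := third_point i j.
  have [<- //|nij] := eqVneq i j.
  by apply: (off k); rewrite eq_sym.
move=> k i j Kk.
have /imsetP[h Hh qh] := subsetP ontoH _ (wc_perm wc k).
have -> : k = h * (h^-1 * k) by rewrite mulKVg.
rewrite dM [RHS]dM !(flatH h) // !mul1g; apply: base_const.
  by rewrite groupM ?groupV // (subsetP sHK).
by rewrite qM permV qh mulVg.
Qed.

Lemma coord_values_total : S \subset <<coord_values [set: wT]>>.
Proof.
apply/subsetP=> s Ss.
have [w _ dw] := wc_surj wc (group1 P) (fun _ : 'I_n => Ss).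
by rewrite -(dw i0) coord_mem_gen ?inE.
Qed.

Lemma coords_not_constant : exists w i j, d w i <> d w j.
Proof.
have [s Ss nts] : exists2 s, s \in S & s != 1.
  by apply/trivgPn; case/simpleP: simS.
have [j [nj0 _]] := third_point i0 i0.
have [|w _ dw] := wc_surj wc (f := fun k => if k == j then s else 1) (group1 P).
  by move=> k; case: ifP; rewrite ?group1.
by exists w, j, i0; rewrite !dw eqxx eq_sym (negPf nj0); apply/eqP.
Qed.

Lemma coord_values_cover A (J : {set wT}) :
  coord_values A :|: \bigcup_(z in J) coord_values [set z]
    = coord_values (A :|: J).
Proof.
apply/setP=> x; apply/setUP/imset2P => [[/imset2P[w i Aw _ ->]|]|[w i AJw _ ->]].
- by exists w i; rewrite ?inE ?Aw.
- case/bigcupP=> z Jz /imset2P[w i /set1P-> _ ->].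
  by exists z i; rewrite ?inE ?Jz ?orbT.
case/setUP: AJw => [Aw|Jw]; first by left; apply/imset2P; exists w i.
by right; apply/bigcupP; exists w => //; apply/imset2P; exists w i; rewrite ?set11.
Qed.

(** Z is a minimal part of X containing Y whose coordinates generate S, and J
    indexes the resulting irredundant family in S. *)
Lemma card_over_anchored (X Y : {set wT}) :
    irredundant_generating [set: wT]%G X -> Y \subset X ->
    P \subset q @: <<Y>> -> anchored <<Y>> ->
  #|X :\: Y| <= max_irredundant S + 1
   /\ (replacement_property S -> #|X :\: Y| <= max_irredundant S).
Proof.
move=> /andP[irrX /eqP genX] sYX ontoY aY.
pose full A := S \subset <<coord_values A>>.
pose good (Z : {set wT}) := (Y \subset Z) && full Z.
have [Z /minsetP[/andP[sYZ fullZ] minZ] sZX] : {Z | minset good Z & Z \subset X}.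
  apply: minset_exists; rewrite /good sYX /full.
  by rewrite -coord_values_gen genX coord_values_total.
have fullG A : full A -> S \subset <<coord_values <<A>>>>.
  by rewrite coord_values_gen.
pose J := Z :\: Y.
have defZ: Y :|: J = Z by rewrite /J setDE setUIr setUCr setIT; apply/setUidPr.
have genJ: <<coord_values Y :|: \bigcup_(z in J) coord_values [set z]>> = S.
  rewrite coord_values_cover defZ; apply/eqP.
  by rewrite eqEsubset coord_values_sub.
have lackZ z: z \in J -> ~~ full (Z :\ z).
  case/setDP=> Zz nYz; apply/negP=> fullZz.
  have := minZ (Z :\ z); rewrite /good fullZz subsetD1 sYZ nYz subsetDl.
  by move=> /(_ isT isT) eqZ; have := setD11 z Z; rewrite eqZ Zz.
have defZz z: z \in J -> Y :|: J :\ z = Z :\ z.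
  case/setDP=> Zz nYz; rewrite -defZ; apply/setP=> y; rewrite !inE.
  by have [->|//] := eqVneq y z; rewrite (negPf nYz).
have irrJ z: z \in J ->
    <<coord_values Y :|: \bigcup_(t in J :\ z) coord_values [set t]>> <> S.
  move=> Jz; rewrite coord_values_cover defZz // => genZz.
  by case/negP: (lackZ z Jz); rewrite /full genZz.
have leJ := leq_card_family genJ irrJ.
have ontoS A : Y \subset A -> P \subset q @: <<A>>.
  by move=> sYA; apply: subset_trans ontoY (imsetS _ (genS sYA)).
have anchS A : Y \subset A -> anchored <<A>>.
  by move=> sYA; apply: anchoredS (genS sYA) aY.
have XDY: #|X :\: Y| = #|J| + #|X :\: Z|.
  rewrite !cardsDS ?(subset_trans sYZ) // addnBAC ?subset_leq_card //.
  by rewrite subnKC ?subset_leq_card.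
have out A x : A \subset X -> x \in X -> x \notin A -> x \notin <<A>>.
  exact: irredundant_notin_gen.
have base_nt A y: Y \subset A -> A \subset X -> y \in A -> y \notin Y ->
    exists2 m, m \in <<A>> & q m = 1 /\ m != 1.
- move=> sYA sAX Ay nYy.
  have [|m Am [qm nHm]] := kernel_grows ontoY (genS sYA) (mem_gen Ay).
    by rewrite out // (subsetP sAX).
  by exists m => //; split=> //; apply: contraNneq nHm => ->.
(* As X is irredundant, an element of X outside x |: A would lie outside the
   subgroup generated by x |: A, which is everything. *)
have last_one A y x : Y \subset A -> A \subset X -> full A ->
    y \in A -> y \notin Y -> x \in X -> x \notin A -> X = x |: A.
- move=> sYA sAX fullA Ay nYy Xx nAx.
  have [m Am [qm ntm]] := base_nt A y sYA sAX Ay nYy.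
  have sxAX: x |: A \subset X by rewrite subUset sub1set Xx.
  have sAxA: <<A>> \subset <<x |: A>> by rewrite genS ?subsetUr.
  have xAall: <<x |: A>> = [set: wT].
    apply: (proper_over_full (x := x) (ontoS A sYA) (anchS A sYA)
      (fullG A fullA) Am qm ntm sAxA).
      by apply: mem_gen; rewrite setU11.
    exact: out.
  apply/eqP; rewrite eqEsubset sxAX andbT; apply/subsetP=> z Xz.
  by apply: contraT => nAz; have := out _ z sxAX Xz nAz; rewrite xAall inE.
have diag A y x : Y \subset A -> A \subset X -> full A ->
    y \in A -> y \notin Y -> x \in X -> x \notin A -> diagonal <<A>>.
- move=> sYA sAX fullA Ay nYy Xx nAx.
  have [m Am [qm ntm]] := base_nt A y sYA sAX Ay nYy.
  have [Aall|//] :=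
    base_dichotomy (ontoS A sYA) (anchS A sYA) (fullG A fullA) Am qm ntm.
  by have := out A x sAX Xx nAx; rewrite Aall inE.
(* If Y = Z, the base part of <Y> may be trivial, and up to two elements can
   remain. *)
have [J0|[y Jy]] := set_0Vmem J.
  suffices le2: #|X :\: Y| <= 2.
    have le_m := leq_trans le2 (max_irredundant_gt1 nabS).
    by split=> // ; rewrite addn1 ltnW.
  have eqZY: Z = Y by rewrite -defZ J0 setU0.
  rewrite eqZY in fullZ.
  have [->|[x XYx]] := set_0Vmem (X :\: Y); first by rewrite cards0.
  rewrite (cardsD1 x) XYx ltnS; have /setDP[Xx nYx] := XYx.
  have [->|[z]] := set_0Vmem ((X :\: Y) :\ x); first by rewrite cards0.
  case/setD1P=> nzx /setDP[Xz nYz].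
  rewrite (last_one (x |: Y) x z) ?subsetUr ?subUset ?sub1set ?Xx ?setU11 //.
  - rewrite -(cards1 z); apply/subset_leq_card/subsetP=> t; rewrite !inE.
    by case: (t == x); case: (t \in Y); rewrite ?orbF.
  - by rewrite /full (subset_trans fullZ) // genS // imset2Sl // subsetUr.
  by rewrite !inE negb_or nzx.
have /setDP[Zy nYy] := Jy.
have [XZ0|[x XZx]] := set_0Vmem (X :\: Z).
  by rewrite XDY XZ0 cards0 addn0 addn1; split=> //; rewrite ltnW.
have /setDP[Xx nZx] := XZx.
have XZ1: #|X :\: Z| = 1%N.
  rewrite (last_one Z y x) // -(cards1 x); congr #|pred_of_set _|.
  apply/setP=> t; rewrite !inE; have [->|_] := eqVneq t x; first by rewrite nZx.
  by rewrite andNb.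
rewrite XDY XZ1; split=> [|repS]; first by rewrite leq_add2r.
rewrite addn1 ltnNge; apply/negP=> geJ.
have [X0 irrX0 [f injf fXA]] := irredundant_family genJ irrJ.
have cX0: #|X0| = max_irredundant S.
  apply/eqP; rewrite eqn_leq leq_max_irredundant //=.
  rewrite (leq_trans geJ) // -(card_in_imset injf).
  apply/subset_leq_card/subsetP=> _ /imsetP[z Jz ->].
  by case/setIP: (fXA z Jz).
have defX0: X0 = f @: J.
  apply/eqP; rewrite eq_sym eqEcard card_in_imset // cX0 geJ andbT.
  by apply/subsetP=> _ /imsetP[z Jz ->]; case/setIP: (fXA z Jz).
(* The replacement property for X0, read back in W: a nontrivial element of S
   makes some member of J superfluous. *)
have swap h: h \in S -> h != 1 ->
    exists2 z, z \in J & forall A, Z :\ z \subset A ->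
      h \in <<coord_values A>> -> full A.
- move=> Sh nth; have [s] := repS X0 irrX0 cX0 h Sh nth.
  rewrite {1}defX0 => /imsetP[z Jz ->] genh.
  exists z => // A sZA Ah; rewrite /full -genh gen_subG subUset sub1set Ah /=.
  apply/subsetP=> u /setD1P[]; rewrite defX0 => nuz /imsetP[t Jt eqt].
  have /setIP[_ /imset2P[t' i /set1P-> _ ft]] := fXA t Jt.
  rewrite eqt ft coord_mem_gen // (subsetP sZA) // !inE.
  have /setDP[-> _] := Jt; rewrite andbT.
  by apply: contraNneq nuz => eqtz; rewrite eqt eqtz.
have sYZz z : z \in J -> Y \subset Z :\ z.
  by case/setDP=> _ nYz; rewrite subsetD1 sYZ.
have flatH h i: h \in <<Y>> -> d h i = 1.
  move=> Hh; apply/set1gP; apply: (@coord_gen 1%G Y) Hh => {}h {}i Yh.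
  apply/set1gP/eqP; apply: contraT => nt.
  have [z Jz fullz] := swap _ (wc_coord wc h i) nt.
  case/negP: (lackZ z Jz); apply: fullz => //.
  by rewrite coord_mem_gen // (subsetP (sYZz z Jz)).
(* Otherwise x would be the element of <Y> over the same permutation. *)
have [i nt]: exists i, d x i != 1.
  apply/existsP; apply: contraT => /existsPn flatx.
  have nYx: x \notin <<Y>>.
    by rewrite out //; apply: contra nZx; apply: (subsetP sYZ).
  have /imsetP[h Hh qh] := subsetP ontoY _ (wc_perm wc x).
  case/negP: nYx; rewrite (_ : x = h) //; apply: (wc_inj wc) => // i.
  by rewrite (flatH h) //; apply/eqP; rewrite -[_ == _]negbK flatx.
have [z Jz fullz] := swap _ (wc_coord wc x i) nt.
have /setDP[Zz nYz] := Jz.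
have nYx: x \notin Y by apply: contra nZx; apply: (subsetP sYZ).
pose Z' := x |: Z :\ z.
have Z'x: x \in Z' by rewrite setU11.
have sYZ': Y \subset Z' by rewrite (subset_trans (sYZz z Jz)) ?subsetUr.
have constZ: forall k j l, k \in <<Z>> -> d k j = d k l.
  exact: flat_diagonal_constant ontoY flatH (genS sYZ) (diag Z y x _ _ _ _ _ _ _).
have constZ': forall k j l, k \in <<Z'>> -> d k j = d k l.
  apply: flat_diagonal_constant ontoY flatH (genS sYZ') _.
  apply: (diag Z' x z) => //.
  - rewrite subUset sub1set Xx; exact: subset_trans (subsetDl _ _) sZX.
  - by apply: fullz; rewrite ?subsetUr // coord_mem_gen.
  - by rewrite (subsetP sZX).
  by rewrite !inE eqxx orbF; apply: contraNneq nZx => <-.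
have [w [j [l]]] := coords_not_constant; apply.
apply: (@coord_constant_gen X); last by rewrite genX inE.
move=> a j' l'; rewrite (last_one Z y x) // => /setU1P[->|Za].
  by apply: constZ'; rewrite mem_gen.
by apply: constZ; rewrite mem_gen.
Qed.

Lemma perm_gen A : q @: <<A>> = <<q @: A>>.
Proof.
have qMT : {in [set: wT] &, {morph q : u v / u * v}} by move=> u v _ _; apply: qM.
by have := morphim_gen (Morphism qMT) (subsetT A); rewrite !morphimEsub ?subsetT.
Qed.

Lemma perm_onto_total : P \subset q @: [set: wT].
Proof.
apply/subsetP=> p Pp; have [|w qw _] := wc_surj wc (f := fun _ => 1) Pp.
  by move=> _; apply: group1.
by apply/imsetP; exists w; rewrite ?inE.
Qed.

(** The sets [set q y], for y in a minimal Y mapping onto P, form an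
    irredundant family generating P. *)
Lemma perm_irredundant_part (X : {set wT}) :
    irredundant_generating [set: wT]%G X ->
  exists2 Y : {set wT}, Y \subset X
    & P \subset q @: <<Y>> /\ #|Y| <= max_irredundant P.
Proof.
case/andP=> _ /eqP genX; pose onto (Y : {set wT}) := P \subset q @: <<Y>>.
have [Y /minsetP[ontoY minY] sYX] : {Y | minset onto Y & Y \subset X}.
  by apply: minset_exists; rewrite /onto genX perm_onto_total.
exists Y => //; split=> //.
have genE (Z : {set wT}) : <<set0 :|: \bigcup_(y in Z) [set q y]>> = q @: <<Z>>.
  rewrite set0U perm_gen; congr <<_>>; apply/setP=> p.
  apply/bigcupP/imsetP=> [[y Zy /set1P->]|[y Zy ->]]; first by exists y.
  by exists y; rewrite ?set11.
apply: (@leq_card_family _ _ Y set0 (fun y => [set q y])) => [|y Yy].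
  rewrite genE; apply/eqP; rewrite eqEsubset -/(onto Y) ontoY andbT.
  by apply/subsetP=> _ /imsetP[w _ ->]; apply: wc_perm wc _.
rewrite genE => genP; have := minY (Y :\ y); rewrite /onto genP subxx subsetDl.
by move=> /(_ isT isT) eqY; have := setD11 y Y; rewrite eqY Yy.
Qed.

(** * Lower bounds from explicit irredundant sets *)

(** The value 1 is a default, for p outside P or f not valued in S. *)
Definition wlift p (f : 'I_n -> gT) : wT :=
  odflt 1 [pick w | (q w == p) && [forall i, d w i == f i]].

Lemma wliftP p f : p \in P -> (forall i, f i \in S) ->
  q (wlift p f) = p /\ d (wlift p f) =1 f.
Proof.
move=> Pp Sf; rewrite /wlift; case: pickP => [w /andP[/eqP qw /forallP dw]|no_w].
  by split=> // i; apply/eqP/dw.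
have [w qw dw] := wc_surj wc Pp Sf; have /andP[] := no_w w.
by rewrite qw eqxx; split=> //; apply/forallP=> i; rewrite dw.
Qed.

Definition flat_lift p := wlift p (fun _ => 1).
Definition constant_lift s := wlift 1 (fun _ => s).
Definition single_lift s := wlift 1 (fun i => if i == i0 then s else 1).

Lemma flat_liftP p : p \in P ->
  q (flat_lift p) = p /\ forall i, d (flat_lift p) i = 1.
Proof. by move=> Pp; apply: wliftP. Qed.

Lemma constant_liftP s : s \in S ->
  q (constant_lift s) = 1 /\ forall i, d (constant_lift s) i = s.
Proof. by move=> Ss; apply: wliftP. Qed.

Lemma single_liftP s : s \in S ->
  q (single_lift s) = 1
   /\ forall i, d (single_lift s) i = if i == i0 then s else 1.
Proof. by move=> Ss; apply: wliftP => // i; case: ifP. Qed.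

Lemma flat_lift_onto (Y : {set 'S_n}) :
  <<Y>> = P -> P \subset q @: <<flat_lift @: Y>>.
Proof.
move=> genY; rewrite perm_gen -{1}genY genS //; apply/subsetP=> p Yp.
have Pp: p \in P by rewrite -genY mem_gen.
by apply/imsetP; exists (flat_lift p); rewrite ?imset_f // (flat_liftP Pp).1.
Qed.

Lemma flat_lift_anchored (Y : {set 'S_n}) :
  <<Y>> = P -> anchored <<flat_lift @: Y>>.
Proof.
move=> genY i j; have [p Pp pi] := move_point i j.
have /imsetP[w Yw qw] := subsetP (flat_lift_onto genY) p Pp.
exists w; rewrite // -qw; split=> //.
apply/set1gP; apply: (@coord_gen 1%G) Yw => _ i' /imsetP[p' Yp' ->].
by rewrite (flat_liftP _).2 ?inE // -genY mem_gen.
Qed.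

(** An element of the base group supported at one point excludes the diagonal
    case of the dichotomy. *)
Lemma flat_lift_generates (Y : {set 'S_n}) (B : {set wT}) h :
    <<Y>> = P -> S \subset <<coord_values B>> ->
    h \in S -> h != 1 -> single_lift h \in <<B>> ->
  <<flat_lift @: Y :|: B>> = [set: wT].
Proof.
move=> genY genB Sh nth Bh; have sYK := genS (subsetUl (flat_lift @: Y) B).
have sBK := genS (subsetUr (flat_lift @: Y) B).
have [qh dh] := single_liftP Sh; have dh0 := dh i0; rewrite eqxx in dh0.
have nth1: single_lift h != 1.
  by apply: contraNneq nth => h1; rewrite -dh0 h1 coord1.
have ontoK := subset_trans (flat_lift_onto genY) (imsetS q sYK).
have aK := anchoredS sYK (flat_lift_anchored genY).
have genK : S \subset <<coord_values <<flat_lift @: Y :|: B>>>>.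
  by rewrite coord_values_gen (subset_trans genB) // genS // imset2Sl // subsetUr.
have [//|dgK] := base_dichotomy ontoK aK genK (subsetP sBK _ Bh) qh nth1.
have [j [nj0 _]] := third_point i0 i0.
have [/(_ (single_lift h)) inj1 _] := dgK j; case/eqP: nth1.
by apply: inj1; rewrite ?(subsetP sBK) // dh (negPf nj0).
Qed.

(** Removing a lift of p is detected in P, because the elements of B vanish
    there. *)
Lemma lower_bound_lift (Y : {set 'S_n}) (B : {set wT}) :
    irredundant_generating P Y -> (forall b, b \in B -> q b = 1) ->
    <<flat_lift @: Y :|: B>> = [set: wT] ->
    (forall b, b \in B -> <<flat_lift @: Y :|: B :\ b>> <> [set: wT]) ->
  #|Y| + #|B| <= max_irredundant [set: wT].
Proof.
move=> /andP[irrY /eqP genY] qB genYB irrB.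
have YP p : p \in Y -> p \in P by move=> Yp; rewrite -genY mem_gen.
have qY p : p \in Y -> q (flat_lift p) = p.
  by move=> Yp; case: (flat_liftP (YP p Yp)).
have injY: {in Y &, injective flat_lift}.
  by move=> p1 p2 Y1 Y2 eq12; rewrite -(qY p1) // eq12 qY.
have YnB p: p \in Y -> flat_lift p \notin B.
  move=> Yp; apply/negP=> /qB; rewrite qY // => p1; rewrite {p}p1 in Yp.
  have := irredundant_notin_gen irrY (sub0set Y) Yp.
  by rewrite inE group1 => /(_ isT).
have disYB: [disjoint flat_lift @: Y & B].
  rewrite disjoint_subset; apply/subsetP=> _ /imsetP[p Yp ->].
  by rewrite inE YnB.
have -> : #|Y| + #|B| = #|flat_lift @: Y :|: B|.
  rewrite cardsU (_ : _ :&: _ = set0) ?cards0 ?subn0 ?card_in_imset //.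
  by apply/eqP; rewrite setI_eq0.
apply: leq_max_irredundant; rewrite /irredundant_generating genYB eqxx andbT.
apply/forall_inP=> x; rewrite genYB => Yx; apply/eqP.
have [Bx genx|nBx] := boolP (x \in B).
  case: (irrB x Bx); apply/eqP; rewrite eqEsubset subsetT -genx genS //.
  by rewrite setDUl setSU // subsetDl.
have /imsetP[p Yp eqx] : x \in flat_lift @: Y.
  by case/setUP: Yx => // Bx; rewrite Bx in nBx.
move=> genx; have := irredundant_notin_gen irrY (subsetDl Y [set p]) Yp.
rewrite setD11 => /(_ isT) /negP[].
have: p \in q @: <<(flat_lift @: Y :|: B) :\ x>>.
  by rewrite genx (subsetP perm_onto_total) ?YP.
rewrite perm_gen; apply: subsetP; rewrite gen_subG.
apply/subsetP=> _ /imsetP[w /setD1P[nwx /setUP[/imsetP[p' Yp' eqw]|Bw]] ->].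
  rewrite eqw qY // mem_gen // !inE Yp' andbT.
  by apply: contraNneq nwx => eqp; rewrite eqw eqx eqp.
by rewrite qB ?group1.
Qed.

Lemma max_wreath_lower : max_irredundant S + max_irredundant P
  <= max_irredundant [set: wT].
Proof.
have [X irrX <-] := max_irredundant_attained S.
have [Y irrY <-] := max_irredundant_attained P.
have [/forall_inP irX /eqP genX] := andP irrX; have [_ /eqP genY] := andP irrY.
have XS s : s \in X -> s \in S by move=> Xs; rewrite -genX mem_gen.
have dX s : s \in X -> d (single_lift s) i0 = s.
  by move=> Xs; rewrite (single_liftP (XS s Xs)).2 eqxx.
have injX : {in X &, injective single_lift}.
  by move=> s t Xs Xt eqst; rewrite -(dX s) // eqst dX.
rewrite addnC -(card_in_imset injX); apply: lower_bound_lift => //.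
- by move=> _ /imsetP[s Xs ->]; case: (single_liftP (XS s Xs)).
- have [s Xs nts]: exists2 s, s \in X & s != 1.
    apply/exists_inP; apply: contraT => /exists_inPn X1.
    case/negP: nabS; rewrite -genX (_ : <<X>> = 1) ?abelian1 //.
    apply/trivgP; rewrite gen_subG; apply/subsetP=> s Xs.
    by rewrite inE -[_ == _]negbK X1.
  apply: (flat_lift_generates genY _ (XS s Xs) nts); last first.
    by rewrite mem_gen ?imset_f.
  rewrite -genX genS //; apply/subsetP=> t Xt; apply/imset2P.
  by exists (single_lift t) i0; rewrite ?imset_f ?dX.
move=> _ /imsetP[s Xs ->] gens; case/eqP: (irX s Xs); apply/eqP.
rewrite eqEsubset genS ?subsetDl //= genX; apply/subsetP=> t St.
have -> : t = d (single_lift t) i0 by rewrite (single_liftP St).2 eqxx.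
have: single_lift t \in [set: wT] by rewrite inE.
rewrite -gens; apply: coord_gen => w i {St t}.
case/setUP=> [/imsetP[p Yp ->]|/setD1P[nws /imsetP[u Xu eqw]]].
  by rewrite (flat_liftP _).2 ?group1 // -genY mem_gen.
rewrite eqw (single_liftP (XS u Xu)).2; case: ifP => // _.
rewrite mem_gen // !inE Xu andbT; apply: contraNneq nws => equs.
by rewrite eqw equs.
Qed.

Lemma max_wreath_lower_succ : ~ replacement_property S ->
  max_irredundant S + max_irredundant P + 1 <= max_irredundant [set: wT].
Proof.
move=> norepS.
have [X [h [irrX cX Sh nth noX]]] : exists X h,
    [/\ irredundant_generating S X, #|X| = max_irredundant S, h \in S, h != 1
      & forall x, x \in X -> <<h |: X :\ x>> != S].
  pose bad X h := [&& irredundant_generating S X, #|X| == max_irredundant S,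
    h \in S, h != 1 & [forall x in X, <<h |: X :\ x>> != S]].
  have [/existsP[X /existsP[h]]|] := boolP [exists X, exists h, bad X h].
    case/and5P=> irrX /eqP cX Sh nth /forall_inP noX.
    by exists X, h.
  move=> /existsPn no_bad; case: norepS => X irrX cX h Sh nth.
  have /existsPn/(_ h) := no_bad X.
  rewrite /bad irrX cX eqxx Sh nth /= => /forall_inPn[x Xx /negPn/eqP genx].
  by exists x.
have [Y irrY cY] := max_irredundant_attained P.
have [_ /eqP genX] := andP irrX; have [_ /eqP genY] := andP irrY.
have XS s : s \in X -> s \in S by move=> Xs; rewrite -genX mem_gen.
have YP p : p \in Y -> p \in P by move=> Yp; rewrite -genY mem_gen.
have injX : {in X &, injective constant_lift}.
  move=> s t Xs Xt eqst.
  have [[_ ds] [_ dt]] := (constant_liftP (XS s Xs), constant_liftP (XS t Xt)).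
  by rewrite -(ds i0) eqst dt.
have not_const: single_lift h \notin constant_lift @: X.
  apply/imsetP=> [[s Xs eqhs]]; case/eqP: nth.
  have [j [nj0 _]] := third_point i0 i0; have [_ dh] := single_liftP Sh.
  have [_ ds] := constant_liftP (XS s Xs); rewrite -eqhs in ds.
  by have := ds i0; rewrite -(ds j) !dh eqxx (negPf nj0).
have cB : #|single_lift h |: constant_lift @: X| = (max_irredundant S + 1)%N.
  by rewrite cardsU1 not_const card_in_imset // cX addnC.
rewrite -addnA (addnC _ 1%N) addnA -cB addnC -cY; apply: lower_bound_lift => //.
- move=> _ /setU1P[->|/imsetP[s Xs ->]]; first by case: (single_liftP Sh).
  by case: (constant_liftP (XS s Xs)).
- apply: (flat_lift_generates genY _ Sh nth); last by rewrite mem_gen ?setU11.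
  rewrite -genX genS //; apply/subsetP=> s Xs; apply/imset2P.
  exists (constant_lift s) i0; rewrite ?inE ?imset_f ?orbT //.
  by rewrite (constant_liftP (XS s Xs)).2.
move=> b /setU1P[->|/imsetP[x Xx ->]] genb.
  have [w [i [j]]] := coords_not_constant; apply.
  have: w \in [set: wT] by rewrite inE.
  rewrite -genb; apply: coord_constant_gen => {}w {}i {}j.
  case/setUP=> [/imsetP[p Yp ->]|/setD1P[nwh /setU1P[eqw|/imsetP[s Xs ->]]]].
  - by rewrite !(flat_liftP (YP p Yp)).2.
  - by rewrite eqw eqxx in nwh.
  by rewrite !(constant_liftP (XS s Xs)).2.
have sSx: <<h |: X :\ x>> \subset S.
  rewrite gen_subG subUset sub1set Sh; apply/subsetP=> s /setD1P[_].
  exact: XS.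
case/negP: (noX x Xx); rewrite eqEsubset sSx; apply/subsetP=> t St.
have -> : t = d (single_lift t) i0 by rewrite (single_liftP St).2 eqxx.
have: single_lift t \in [set: wT] by rewrite inE.
rewrite -genb; apply: coord_gen => w i {St t}.
case/setUP=> [/imsetP[p Yp ->]|/setD1P[nwx /setU1P[->|/imsetP[u Xu eqw]]]].
- by rewrite (flat_liftP (YP p Yp)).2 group1.
- by rewrite (single_liftP Sh).2; case: ifP; rewrite ?group1 // mem_gen ?setU11.
rewrite eqw (constant_liftP (XS u Xu)).2 mem_gen // !inE Xu andbT.
by apply/orP; right; apply: contraNneq nwx => equx; rewrite eqw equx.
Qed.

End WreathCoordinates.

(** * Changing the identification of the copies of S *)

Section Regauge.

Variables (gT wT : finGroupType) (n : nat) (S : {group gT}) (P : {group 'S_n}).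
Variables (q : wT -> 'S_n) (d : wT -> 'I_n -> gT).
Hypothesis wc : wreath_coordinates S P q d.

Definition regauge (e : 'I_n -> gT) w i := e i * d w i * (e (q w i))^-1.

Lemma regauge_coordinates e :
  (forall i, e i \in S) -> wreath_coordinates S P q (regauge e).
Proof.
move=> Se; split=> [u v|u v i|u|u i|u v eqq eqd|p f Pp Sf].
- exact: wc_permM wc u v.
- rewrite /regauge (wc_coordM wc) (wc_permM wc) permM !mulgA.
  by rewrite mulgKV.
- exact: wc_perm wc u.
- by rewrite !groupM ?groupV ?(wc_coord wc).
- apply: (wc_inj wc) => // i; have := eqd i; rewrite /regauge eqq.
  by move/mulIg/mulgI.
have [|u qu du] := wc_surj wc (f := fun i => (e i)^-1 * f i * e (p i)) Pp.
  by move=> i; rewrite !groupM ?groupV.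
by exists u => // i; rewrite /regauge du qu !mulgA mulgV mul1g mulgK.
Qed.

(** Pick w i in H moving i0 to i and use it to identify the copy of S at i with
    the copy at i0: the transporter (w i)^-1 * w j from i to j then becomes
    trivial. *)
Lemma regauge_anchored (H : {group wT}) i0 :
    (forall i, exists2 w, w \in H & q w i0 = i) ->
  exists2 e, forall i, e i \in S & anchored q (regauge e) H.
Proof.
move=> transH; have [w Hw qw] := fin_all_exists2 transH.
exists (fun i => d (w i) i0) => [i|i j]; first exact: wc_coord wc _ _.
exists ((w i)^-1 * w j); first by rewrite groupM ?groupV.
have qi: q (w i)^-1 i = i0 by rewrite (permV wc) -{2}(qw i) permK.
rewrite /regauge (wc_permM wc) permM qi qw; split=> //.
have dV: d (w i)^-1 i = (d (w i) i0)^-1 by rewrite -(coordV wc) qw.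
rewrite (wc_coordM wc) qi dV.
by rewrite !mulgA mulgV mul1g mulgV.
Qed.

End Regauge.

Section WreathBounds.

Variables (gT wT : finGroupType) (n : nat) (S : {group gT}) (P : {group 'S_n}).
Variables (q : wT -> 'S_n) (d : wT -> 'I_n -> gT).
Hypothesis wc : wreath_coordinates S P q d.
Hypotheses (simS : simple S) (nabS : ~~ abelian S).
Hypothesis tr2 : forall i j k l : 'I_n, i != j -> k != l ->
  exists2 p, p \in P & p i = k /\ p j = l.
Variable i0 : 'I_n.
Hypothesis third_point : forall i j : 'I_n, exists k, k != i /\ k != j.

Lemma max_wreath_upper :
  max_irredundant [set: wT] <= max_irredundant S + max_irredundant P + 1
   /\ (replacement_property S ->
       max_irredundant [set: wT] <= max_irredundant S + max_irredundant P).
Proof.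
have [X irrX <-] := max_irredundant_attained [set: wT].
have [Y sYX [ontoY leY]] := perm_irredundant_part wc irrX.
have [|e Se aY] := @regauge_anchored _ _ _ _ _ _ _ wc <<Y>>%G i0.
  move=> i; have [p Pp pi0] := move_point tr2 third_point i0 i.
  by have /imsetP[w Hw qw] := subsetP ontoY p Pp; exists w; rewrite -?qw.
have [leX repX] := card_over_anchored (regauge_coordinates wc Se) simS nabS tr2
  i0 third_point irrX sYX ontoY aY.
have -> : #|X| = #|X :\: Y| + #|Y|.
  by rewrite cardsDS // subnK // subset_leq_card.
split=> [|/repX leXY]; last exact: leq_add.
by rewrite addnAC leq_add.
Qed.

End WreathBounds.

(** * The wreath product *)

Section WreathProductCoordinates.

Variables (gT : finGroupType) (n : nat) (S : {group gT}) (P : {group 'S_n}).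

Definition wreath_perm (w : wreath S P) : 'S_n := (pair_of_sd w).1.

(** A pair (p, f) stands for the product of p and f in this order, so f is read
    at the image of i. *)
Definition wreath_coord (w : wreath S P) i : gT :=
  (pair_of_sd w).2 (wreath_perm w i).

Lemma wreath_has_coordinates :
  wreath_coordinates S P wreath_perm wreath_coord.
Proof.
have mem (w : wreath S P) :
    (wreath_perm w \in P) /\ forall i, (pair_of_sd w).2 i \in S.
  case: w => -[p f] pf; rewrite /wreath_perm /=.
  by case/setXP: (pf) => Pp /setXnP.
split=> [//|[[p f] pf] [[p' f'] pf'] i|w|w i|[[p f] pf] [[p' f'] pf'] |p f Pp Sf].
- have /setXP[/= Pp Sf] := pf; have /setXP[/= Pp' Sf'] := pf'.
  rewrite /wreath_coord /wreath_perm /= permM.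
  by rewrite /= actbyE //= !ffunE permK.
- by case: (mem w).
- by case: (mem w) => _; apply.
- rewrite /wreath_coord /wreath_perm /= => eqp eqf; apply: val_inj => /=.
  congr (_, _) => //; apply/ffunP=> j.
  by have := eqf (p^-1 j); rewrite -eqp permKV.
have pf : (p, [ffun j => f (p^-1 j)]) \in setX P (base_group n S).
  by rewrite inE Pp; apply/setXnP=> j; rewrite ffunE.
exists (SdPair (wreath_action S P) pf) => // i.
by rewrite /wreath_coord /wreath_perm /= ffunE permK.
Qed.

End WreathProductCoordinates.

Theorem theorem10 (gT : finGroupType) (S : {group gT})
    (n : nat) (P : {group 'S_n}) :
  simple S -> ~~ abelian S ->
  (2 <= n)%N -> [transitive^2 P, on [set: 'I_n] | 'P] ->
  ~~ (P \isog [set: 'Z_2]) ->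
  [/\ (max_irredundant S + max_irredundant P
         <= max_irredundant (wreath_group S P)
         <= max_irredundant S + max_irredundant P + 1)%N,
      ~ replacement_property S ->
        max_irredundant (wreath_group S P)
          = (max_irredundant S + max_irredundant P + 1)%N
    & replacement_property S ->
        max_irredundant (wreath_group S P)
          = (max_irredundant S + max_irredundant P)%N].
Proof.
move=> simS nabS n_gt1 tr2P notZ2.
have tr2 (i j k l : 'I_n) : i != j -> k != l ->
    exists2 p, p \in P & p i = k /\ p j = l.
  move=> nij nkl.
  have dt (a b : 'I_n) : a != b -> [tuple a; b] \in 2.-dtuple([set: 'I_n]).
    by move=> nab; rewrite inE memtE subset_all /= !inE nab.
  have [p Pp [-> ->]] := atransP2 tr2P (dt i j nij) (dt k l nkl).
  by exists p.
have i0 : 'I_n := Ordinal (ltnW n_gt1).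
have n_gt2 : 2 < n.
  rewrite ltn_neqAle n_gt1 andbT; apply: contra notZ2 => /eqP n2.
  (* On two points P has order 2: it moves a point and has order at most 2!. *)
  have n01: Ordinal (ltnW n_gt1) != Ordinal n_gt1 by [].
  have n10: Ordinal n_gt1 != Ordinal (ltnW n_gt1) by [].
  have [p Pp [p0 _]] := tr2 _ _ _ _ n01 n10.
  have cP: #|P| = 2.
    apply/eqP; rewrite eqn_leq; apply/andP; split.
      by rewrite (leq_trans (subset_leq_card (subsetT P))) // cardsT card_Sn -n2.
    rewrite cardG_gt1; apply: contraNneq n10 => P1; rewrite P1 in Pp.
    by rewrite -p0 (set1gP Pp) perm1.
  have cycP: cyclic P by rewrite prime_cyclic ?cP.
  rewrite (isog_cyclic_card _ cycP) cP cardsT card_ord eqxx andbT.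
  by rewrite (@prime_cyclic _ [set: 'Z_2]%G) // cardsT card_ord.
have third_point (i j : 'I_n) : exists k, k != i /\ k != j.
  have [k nk] : exists k, k \notin [set i; j].
    apply/existsP; apply: contraLR n_gt2 => /existsPn all_ij.
    rewrite -leqNgt -[n]card_ord -cardsT (leq_trans _ (_ : #|[set i; j]| <= 2)) //.
      by apply/subset_leq_card/subsetP=> k _; rewrite -[_ \in _]negbK all_ij.
    by rewrite cards2; case: eqP.
  by exists k; apply/andP; rewrite -negb_or -in_set2.
have wc := wreath_has_coordinates S P.
have lower := max_wreath_lower wc simS nabS tr2 i0 third_point.
have lower1 := max_wreath_lower_succ wc simS nabS tr2 i0 third_point.
have [upper1 upper] := max_wreath_upper wc simS nabS tr2 i0 third_point.
split=> [|norepS|repS]; first by apply/andP.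
  by apply/eqP; rewrite eqn_leq upper1 lower1.
by apply/eqP; rewrite eqn_leq upper // lower.
Qed.
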